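(* The class of $\{$bull, odd hole$\}$-free graphs is $\chi$-bounded, i.e.\ there exists a function $f$ such that every $\{$bull, odd hole$\}$-free graph $G$ satisfies $\chi(G)\le f(\omega(G))$.
   Context: The bull is the graph with vertex set $\{x_1,x_2,x_3,y,z\}$ and edge set $\{x_1x_2,x_1x_3,x_2x_3,x_1y,x_2z\}$. A hole is an induced chordless cycle of length at least 4; it is odd if its length is odd. A graph is $\{$bull, odd hole$\}$-free if it contains neither a bull nor an odd hole as an induced subgraph. $\chi(G)$ is the chromatic number and $\omega(G)$ the maximum clique size. *)

(* Defs.v *)
From mathcomp Require Import all_boot.

Set Implicit Arguments.
Unset Strict Implicit.
Unset Printing Implicit Defensive.

Record sgraph := SGraph {
  vertex :> finType;
  edge : rel vertex;
  edge_sym : symmetric edge;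
  edge_irr : irreflexive edge }.

Definition induced_subgraph (H G : sgraph) : Prop :=
  exists f : H -> G,
    injective f /\ forall x y : H, edge (f x) (f y) = edge x y.

Section GraphOfRel.
Variables (T : finType) (r : rel T).

Definition simple_closure : rel T := [rel x y | (x != y) && (r x y || r y x)].

Lemma simple_closure_sym : symmetric simple_closure.
Proof. by move=> x y /=; rewrite /simple_closure /= eq_sym orbC. Qed.

Lemma simple_closure_irr : irreflexive simple_closure.
Proof. by move=> x; rewrite /simple_closure /= eqxx. Qed.

Definition graph_of_rel := SGraph simple_closure_sym simple_closure_irr.
End GraphOfRel.

(* x1, x2, x3, y, z are 0, 1, 2, 3, 4. *)
Definition bull_arcs : seq (nat * nat) :=
  [:: (0, 1); (0, 2); (1, 2); (0, 3); (1, 4)].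

Definition bull : sgraph :=
  graph_of_rel [rel i j : 'I_5 | (val i, val j) \in bull_arcs].

(* [ordS i] is [i + 1] modulo [n]; this is the cycle C_n as soon as [3 <= n]. *)
Definition cycle_graph (n : nat) : sgraph :=
  graph_of_rel [rel i j : 'I_n | j == ordS i].

Definition has_odd_hole (G : sgraph) : Prop :=
  exists n : nat, [/\ 4 <= n, odd n & induced_subgraph (cycle_graph n) G].

Definition bull_odd_hole_free (G : sgraph) : Prop :=
  ~ induced_subgraph bull G /\ ~ has_odd_hole G.

Definition clique (G : sgraph) (A : {set G}) : bool :=
  [forall x in A, forall y in A, (x != y) ==> edge x y].

Definition clique_number (G : sgraph) : nat :=
  \max_(A : {set G} | clique A) #|A|.

Definition proper_coloring (G : sgraph) (k : nat) (c : {ffun G -> 'I_k}) :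
    bool :=
  [forall x, forall y, edge x y ==> (c x != c y)].

Definition colorable (G : sgraph) (k : nat) : bool :=
  [exists c : {ffun G -> 'I_k}, proper_coloring c].

Lemma ex_colorable (G : sgraph) : exists k, colorable G k.
Proof.
exists #|G|; apply/existsP; exists [ffun x => enum_rank x].
apply/forallP => x; apply/forallP => y; apply/implyP => exy.
rewrite !ffunE (inj_eq enum_rank_inj).
by apply: contraTneq exy => ->; rewrite edge_irr.
Qed.

Definition chromatic_number (G : sgraph) : nat := ex_minn (ex_colorable G).

Definition chi_bounded (C : sgraph -> Prop) : Prop :=
  exists f : nat -> nat,
    forall G : sgraph, C G -> chromatic_number G <= f (clique_number G).

(* Main.v *)
Require Import Defs.
From mathcomp Require Import all_boot zify.

(** Induction on the clique number. Fix a vertex [v] of a connected graph, let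
    [C] be a component of what remains after deleting [v] and its neighbors,
    let [u] be a neighbor of [v] with a neighbor in [C], and layer
    [{v, u} + C] by the distance to [v]. If [u'] lies in the layer above a
    connected subset [X] of a layer, then bull-freeness makes every component
    of [N(u') & X] a homogeneous set of [X]. So either some [u'] is complete
    to [X], which lowers the clique number, or each [u'] has a stable
    neighborhood in the quotient of [X] by its maximal proper homogeneous
    sets. In that case a triangle of the quotient would, again by
    bull-freeness, yield a triangle of parents in the layer above, and so on
    up to the layer [{u}], which is absurd. Hence the quotient has neither
    triangles nor odd holes and is bipartite, while the homogeneous sets have
    smaller clique number than [X]. *)

Set Implicit Arguments.
Unset Strict Implicit.
Unset Printing Implicit Defensive.

(** * Walks and distances *)

Section Walks.
Variables (T : finType) (r : rel T).

(** The length is exact and vertices may repeat, so that walks can be cut and spliced in parity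
    arguments. *)
Fixpoint walk n (x y : T) : bool :=
  if n is m.+1 then [exists z, walk m x z && r z y] else x == y.

Lemma walkS n x y z : walk n x y -> r y z -> walk n.+1 x z.
Proof. by move=> wxy ryz /=; apply/existsP; exists y; rewrite wxy. Qed.

Lemma walk_cat m n x y z : walk m x y -> walk n y z -> walk (m + n) x z.
Proof.
move=> wxy; elim: n z => [|n IHn] z /=; first by rewrite addn0 => /eqP <-.
by case/existsP=> t /andP[wyt rtz]; rewrite addnS; apply: walkS rtz; apply: IHn.
Qed.

Lemma walk_fun n x y : walk n x y ->
  exists w : nat -> T,
    [/\ w 0 = x, w n = y & forall i, i < n -> r (w i) (w i.+1)].
Proof.
elim: n y => [|n IHn] y /=; first by move/eqP->; exists (fun=> y).
case/existsP=> z /andP[/IHn[w [w0 wn wS]] rzy].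
exists (fun i => if i <= n then w i else y); split; rewrite ?ltnn //.
move=> i; rewrite ltnS; case: (ltngtP i n) => // [lt_in|->] _; first exact: wS.
by rewrite wn.
Qed.

Lemma walk_segment (w : nat -> T) n i d :
  (forall i, i < n -> r (w i) (w i.+1)) -> i + d <= n ->
  walk d (w i) (w (i + d)).
Proof.
move=> wS; elim: d => [|d IHd] le_n; first by rewrite addn0 /=.
by apply: (@walkS _ _ (w (i + d))); [apply: IHd | rewrite addnS; apply: wS]; lia.
Qed.

Lemma connect_walk x y : connect r x y -> exists n, walk n x y.
Proof.
case/connectP=> p; elim/last_ind: p y => [|p z IHp] y /=.
  by move=> _ ->; exists 0 => /=.
rewrite rcons_path last_rcons => /andP[/IHp/(_ erefl)[n wn] rz ->].
by exists n.+1; apply: walkS rz.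
Qed.

Hypothesis r_sym : symmetric r.

Lemma walk_sym n x y : walk n x y -> walk n y x.
Proof.
move/walk_fun=> [w [<- <-]]; elim: n => [|n IHn] wS //=.
have r1 : walk 1 (w n.+1) (w n).
  by apply/existsP; exists (w n.+1); rewrite /= eqxx r_sym wS.
by apply: walk_cat r1 (IHn _) => i lt_in; apply: wS; lia.
Qed.

Lemma walk_distance (x : T) : exists d : T -> nat,
  [/\ forall y, connect r x y -> walk (d y) x y,
      forall n y, walk n x y -> d y <= n & d x = 0].
Proof.
(* The second disjunct makes the minimum exist everywhere: vertices out of reach get the value 0. *)
have ex y : exists n, (walk n x y) || ~~ connect r x y.
  case: (boolP (connect r x y)) => [/connect_walk[n wn]|_].
    by exists n; rewrite wn.
  by exists 0; rewrite orbT.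
exists (fun y => ex_minn (ex y)); split=> [y cxy|n y wn|].
- by case: ex_minnP => n; rewrite cxy orbF.
- by case: ex_minnP => m _; apply; rewrite wn.
- by case: ex_minnP => m _ /(_ 0); rewrite /= eqxx => /(_ isT); case: m.
Qed.
End Walks.

(** * Recognizing bulls and odd holes *)

Section Graph.
Variable G : sgraph.
Local Notation e := (@edge G).
Implicit Types (X Y A B C D P S : {set G}) (x y z u v w a b c : G).

(** Distinctness comes for free: for any two of the five vertices, some vertex is adjacent to one
    and not to the other. *)
Lemma bull_induced x1 x2 x3 y z :
  e x1 x2 -> e x1 x3 -> e x2 x3 -> e x1 y -> e x2 z ->
  ~~ e y x2 -> ~~ e y x3 -> ~~ e z x1 -> ~~ e z x3 -> ~~ e y z ->
  induced_subgraph bull G.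
Proof.
move=> e12 e13 e23 e1y e2z n2y n3y n1z n3z nyz.
have [s i] := (@edge_sym G, @edge_irr G).
have neq (p q t : G) : e p t -> ~~ e q t -> p != q.
  by move=> ept; apply: contraNneq => <-.
have U : uniq [:: x1; x2; x3; y; z].
  have [s12 s13 s23] : [/\ e x2 x1, e x3 x1 & e x3 x2] by split; rewrite s.
  rewrite /= !inE !negb_or !andbT -!andbA.
  do ?[apply/andP; split].
  - by apply: neq e12 _; rewrite i.
  - by apply: neq e13 _; rewrite i.
  - by apply: neq e12 _.
  - by apply: neq e13 _.
  - by apply: neq e23 _; rewrite i.
  - by apply: neq e23 _.
  - by apply: neq s12 _.
  - by apply: neq s23 _.
  - by apply: neq s13 _.
  - by apply: neq (_ : e y x1) n1z; rewrite s.
exists (fun j : bull => nth x1 [:: x1; x2; x3; y; z] (j : 'I_5)); split.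
  move=> j k /eqP; rewrite nth_uniq ?(ltn_ord (_ : 'I_5)) // => /eqP jk.
  exact: val_inj.
move=> [[|[|[|[|[|j]]]]] lj] [[|[|[|[|[|k]]]]] lk];
  rewrite /= /simple_closure /= /bull_arcs ?i //= ?inE //=;
  rewrite -?[_ == _ :> 'I__]/(_ == _ :> nat) /=;
  (exact/negbTE || by rewrite s; (assumption || exact/negbTE)).
Qed.

Lemma odd_hole_of_walk (w : nat -> G) n : odd n -> 4 <= n -> w n = w 0 ->
  (forall i, i < n -> e (w i) (w i.+1)) ->
  (forall i j, i < j -> j < n -> w i <> w j) ->
  (forall i j, i < j -> j < n -> e (w i) (w j) ->
     j = i.+1 \/ i = 0 /\ j.+1 = n) ->
  has_odd_hole G.
Proof.
move=> on n4 wn wS winj wch; exists n; split=> //.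
exists (fun i : cycle_graph n => w (i : 'I_n)); split.
  move=> i j eij; apply: val_inj => /=.
  case: (ltngtP (val (i : 'I_n)) (val (j : 'I_n))) => // lt_ij.
    by case: (winj _ _ lt_ij (ltn_ord (j : 'I_n)) eij).
  by case: (winj _ _ lt_ij (ltn_ord (i : 'I_n)) (esym eij)).
have main (i j : 'I_n) : i < j -> e (w i) (w j) = (j == ordS i) || (i == ordS j).
  move=> lt_ij; apply/idP/orP.
    case/(wch _ _ lt_ij (ltn_ord j)) => [jE|[i0 jE]]; [left | right].
      by apply/eqP/val_inj; rewrite /= modn_small -jE // ltn_ord.
    by apply/eqP/val_inj; rewrite /= jE modnn.
  case=> /eqP /(congr1 val) /= E.
    have iS : i.+1 < n by have := ltn_ord j; lia.
    by rewrite E modn_small //; apply: wS; apply: ltn_ord.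
  have jn : j.+1 = n.
    have := ltn_ord j; rewrite leq_eqVlt => /predU1P[//|jn].
    by move: E; rewrite modn_small //; lia.
  by rewrite E jn modnn edge_sym -wn; have := wS _ (ltn_ord j); rewrite jn.
move=> i j /=; rewrite /simple_closure /=.
case: (ltngtP (i : 'I_n) (j : 'I_n)) => lt_ij.
- have -> : i != j by apply: contraTneq lt_ij => ->; rewrite ltnn.
  by rewrite main.
- have -> : i != j by apply: contraTneq lt_ij => ->; rewrite ltnn.
  by rewrite edge_sym main // orbC.
- by rewrite (val_inj lt_ij) edge_irr eqxx.
Qed.

(** * Colorings, cliques and components of vertex sets *)

Definition colorable_on X k := exists c : G -> nat,
  {in X, forall x, c x < k} /\ {in X &, forall x y, e x y -> c x <> c y}.

Definition clique_bound X k :=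
  forall A, A \subset X -> clique A -> #|A| <= k.

(* [linked true X]: X is connected; [linked false X]: its complement graph is. *)
Definition linked (t : bool) X := [forall A : {set G},
  (A \proper X) && (A != set0) ==>
    [exists a in A, exists b in X :\: A, e a b == t]].

(** These are the modules of modular decomposition, the trivial ones included. *)
Definition homogeneous X D := (D \subset X) &&
  [forall x in X :\: D, forall a in D, forall b in D, e x a == e x b].

Lemma linkedP t X : reflect
  (forall A, A \proper X -> A != set0 ->
     exists a b, [/\ a \in A, b \in X :\: A & e a b = t])
  (linked t X).
Proof.
apply: (iffP forallP) => [H A pA nA|H A].
  have := H A; rewrite pA nA => /exists_inP[a aA /exists_inP[b bX /eqP E]].
  by exists a, b.
apply/implyP=> /andP[pA nA]; have [a [b [aA bX E]]] := H _ pA nA.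
by apply/exists_inP; exists a => //; apply/exists_inP; exists b => //; apply/eqP.
Qed.

Lemma unlinkedP t X : ~~ linked t X -> exists A,
  [/\ A \proper X, A != set0 &
      {in A & X :\: A, forall a b, e a b = ~~ t}].
Proof.
case/forallPn=> A; rewrite negb_imply => /andP[/andP[pA nA] H].
exists A; split=> // a b aA bX; apply/eqP; move: H; apply: contraNT => E.
apply/exists_inP; exists a => //; apply/exists_inP; exists b => //.
by move: E; case: t; case: (e a b).
Qed.

Lemma homogeneousP X D : reflect
  (D \subset X /\ forall x a b, x \in X -> x \notin D -> a \in D -> b \in D ->
     e x a = e x b)
  (homogeneous X D).
Proof.
apply: (iffP andP) => -[sD H]; split=> //.
  move=> x a b xX xD aD bD; apply/eqP.
  move/forall_inP: H => /(_ x); rewrite inE xX xD => /(_ isT)/forall_inP.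
  by move=> /(_ a aD)/forall_inP; apply.
apply/forall_inP=> x /setDP[xX xD]; apply/forall_inP=> a aD.
by apply/forall_inP=> b bD; apply/eqP; apply: H.
Qed.

Lemma colorable_onW X Y k l : Y \subset X -> k <= l ->
  colorable_on X k -> colorable_on Y l.
Proof.
move=> /subsetP sYX le_kl [c [ck cP]]; exists c; split=> [x /sYX/ck|].
  by move/leq_trans; apply.
by move=> x y /sYX xX /sYX yX; apply: cP.
Qed.

Lemma colorable_on0 k : colorable_on set0 k.
Proof. by exists (fun=> 0); split=> x; rewrite inE. Qed.

Lemma colorable_on_stable X k : 0 < k -> {in X &, forall x y, ~~ e x y} ->
  colorable_on X k.
Proof.
by move=> k0 H; exists (fun=> 0); split=> // x y xX yX; rewrite (negbTE (H _ _ xX yX)).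
Qed.

(** The color of [x] encodes the pair of [d x] and its color inside its fiber; an edge on which [d]
    is constant stays inside one fiber. *)
Lemma colorable_on_fibers (I : finType) X (g : G -> I) (d : G -> nat) m k :
  {in X, forall x, d x < m} ->
  {in X &, forall x y, e x y -> d x = d y -> g x = g y} ->
  (forall i, colorable_on [set x in X | g x == i] k) ->
  colorable_on X (m * k).
Proof.
move=> dm dg /fin_all_exists[c cP].
exists (fun x => d x * k + c (g x) x); split.
  move=> x xX; have [/(_ x) ck _] := cP (g x).
  have {}ck : c (g x) x < k by apply: ck; rewrite inE xX eqxx.
  by have := dm x xX; nia.
move=> x y xX yX exy.
have [/(_ x) ckx cN] := cP (g x); have [/(_ y) cky _] := cP (g y).
rewrite !inE xX yX !eqxx in ckx cky.
move: ckx cky => /(_ isT) ckx /(_ isT) cky E.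
have dE : d x = d y by nia.
have gE := dg x y xX yX exy dE.
by apply: (cN x y) => //; rewrite ?inE ?xX ?yX ?gE ?eqxx //; rewrite gE dE in E *; lia.
Qed.

(** For [m = 1] no edge crosses and both sides share one palette; for larger [m] they get disjoint
    palettes. *)
Lemma colorable_on_split X A m k :
  0 < m -> {in A & X :\: A, forall a b, e a b -> 1 < m} ->
  colorable_on (X :&: A) k -> colorable_on (X :\: A) k -> colorable_on X (m * k).
Proof.
move=> m0 mA cA cB.
apply: (@colorable_on_fibers _ _ (fun x => x \in A)
          (fun x => (1 < m) && (x \in A))) => [x xX|x y xX yX exy|b].
- by case: (ltnP 1 m) => //=; case: (x \in A).
- case: (boolP (x \in A)); case: (boolP (y \in A)) => // yA xA.
    by rewrite (mA x y) // inE yA.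
  by rewrite (mA y x) // ?inE ?xA // edge_sym.
- case: b; [move: cA | move: cB]; apply: colorable_onW => //;
    by apply/subsetP => x; rewrite !inE; case: (x \in A); rewrite ?andbT ?andbF.
Qed.

(** Take [C] minimal among the sets containing [a] that send no edge to the rest of [Y]. A cut of
    [C] without edges would make the side of [a] a smaller such set. *)
Lemma component Y a : a \in Y -> exists C,
  [/\ C \subset Y, a \in C, linked true C &
      {in C & Y :\: C, forall x y, ~~ e x y}].
Proof.
move=> aY.
pose ok C := [&& C \subset Y, a \in C &
  [forall x in C, forall y in Y :\: C, ~~ e x y]].
have okY : ok Y.
  rewrite /ok subxx aY; apply/forall_inP=> x _; apply/forall_inP=> y.
  by rewrite setDv inE.
have [C /minsetP[/and3P[sCY aC /forall_inP H] Cmin] _] := minset_exists okY.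
have {}H : {in C & Y :\: C, forall x y, ~~ e x y}.
  by move=> x y /H/forall_inP; apply.
exists C; split=> //; apply: contraT => /unlinkedP[A [pA nA nE]].
have sAC := proper_sub pA.
have okA B : B \subset C -> a \in B -> {in B & C :\: B, forall x y, e x y = false} ->
    B = C.
  move=> sBC aB nB; apply: Cmin => //; rewrite /ok (subset_trans sBC) // aB.
  apply/forall_inP=> x xB; apply/forall_inP=> y /setDP[yY yB].
  case: (boolP (y \in C)) => yC; first by rewrite nB // inE yB.
  by apply: H; rewrite ?inE ?yC // (subsetP sBC).
case: (boolP (a \in A)) => aA.
  by move: pA; rewrite (okA A) ?properxx.
move/set0Pn: nA => [x xA]; have xC := subsetP sAC _ xA.
have := okA (C :\: A) (subsetDl _ _); rewrite inE aA aC => /(_ isT) E.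
have : x \in C :\: A.
  rewrite E // => y z yD; rewrite !inE negb_and negbK => /andP[+ zC].
  by rewrite zC orbF => zA; rewrite edge_sym; apply: nE.
by rewrite inE xA.
Qed.

Lemma colorable_on_components Y k :
  (forall C, C \subset Y -> linked true C ->
     {in C & Y :\: C, forall x y, ~~ e x y} -> colorable_on C k) ->
  colorable_on Y k.
Proof.
have [m] := ubnP #|Y|; elim: m Y => // m IHm Y ltY H.
have [->|[a aY]] := set_0Vmem Y; first exact: colorable_on0.
have [C [sCY aC lC nC]] := component aY.
rewrite -[k]mul1n; apply: (@colorable_on_split _ C) => //.
- by move=> x y xC yD; rewrite (negbTE (nC _ _ xC yD)).
- by rewrite (setIidPr sCY); apply: H.
apply: IHm => [|D sD lD nD].
  apply: leq_trans (ltY : #|Y| <= m); apply: proper_card.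
  by apply/properP; split; [apply: subsetDl | exists a; rewrite // inE aC].
have sDY : D \subset Y by apply: subset_trans sD (subsetDl _ _).
apply: H => // x y xD /setDP[yY yD].
case: (boolP (y \in C)) => yC; last by apply: nD => //; rewrite !inE yD yC.
by rewrite edge_sym; apply: nC => //; apply: (subsetP sD).
Qed.

Lemma clique_boundW X Y k : Y \subset X -> clique_bound X k -> clique_bound Y k.
Proof. by move=> sYX H A sAY; apply: H; apply: subset_trans sYX. Qed.

Lemma clique_bound0 X : clique_bound X 0 -> X = set0.
Proof.
move=> H; have [//|[x xX]] := set_0Vmem X.
have := H [set x]; rewrite sub1set cards1 => /(_ xX).
have -> : clique [set x]; last by move/(_ isT).
by apply/forall_inP=> a /set1P->; apply/forall_inP=> b /set1P->; rewrite eqxx.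
Qed.

Lemma clique_bound_nbr X Y x k : Y \subset X -> x \in X ->
  {in Y, forall y, e x y} -> clique_bound X k.+1 -> clique_bound Y k.
Proof.
move=> sYX xX xY H A sAY cA.
have xA : x \notin A.
  by apply/negP=> /(subsetP sAY)/xY; rewrite edge_irr.
have := H (x |: A); rewrite cardsU1 xA add1n ltnS; apply.
  by rewrite subUset sub1set xX (subset_trans sAY).
apply/forall_inP=> a /setU1P[->|aA]; apply/forall_inP=> b /setU1P[->|bA].
- by rewrite eqxx.
- by rewrite xY ?implybT // (subsetP sAY).
- by rewrite edge_sym xY ?implybT // (subsetP sAY).
- by move/forall_inP: cA => /(_ a aA)/forall_inP; apply.
Qed.

(* A shortest odd closed walk has no chord and no repeated vertex: either
   would cut it into two closed walks, one of which is odd. *)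
Lemma triangle_free_bipartite P : ~ has_odd_hole G ->
  (forall a b c, a \in P -> b \in P -> c \in P ->
     e a b -> e b c -> e a c -> False) ->
  colorable_on P 2.
Proof.
move=> noh notri.
pose r := [rel x y | [&& x \in P, y \in P & e x y]].
have r_sym : symmetric r by move=> x y /=; rewrite edge_sym andbCA.
have noodd n x : odd n -> ~~ walk r n x x.
  have [N] := ubnP n; elim: N n x => // N IHN n x ltn on; apply/negP=> /walk_fun.
  case=> w [w0 wn wS]; have {}wn : w n = w 0 by rewrite w0.
  have short m y : odd m -> m < n -> walk r m y y -> False.
    by move=> om lt_mn; apply/negP/IHN => //; lia.
  have seg i j : i <= j -> j <= n -> walk r (j - i) (w i) (w j).
    move=> le_ij le_jn; have := walk_segment (d := j - i) (i := i) wS.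
    by rewrite subnKC //; apply.
  (* The complementary arc, through [w n = w 0]. *)
  have rest i j : i <= j -> j <= n -> walk r (n - j + i) (w j) (w i).
    move=> le_ij le_jn; apply: (@walk_cat _ _ _ _ _ (w 0)).
      by rewrite -wn; apply: seg.
    by rewrite -{1}[i]subn0; apply: seg => //; apply: leq_trans le_jn.
  have wP i : i < n -> w i \in P by case/wS/and3P.
  have n1 : n <> 1.
    move=> n1; rewrite {}n1 in wn wS {wP seg rest short}.
    by have /and3P[_ _] := wS 0 isT; rewrite wn edge_irr.
  have n3 : n <> 3.
    move=> n3; rewrite {}n3 in wn wS wP {seg rest short}.
    have edgeW i : i < 3 -> e (w i) (w i.+1) by case/wS/and3P.
    apply: (notri (w 0) (w 1) (w 2)); rewrite ?wP ?edgeW //.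
    by rewrite edge_sym -wn edgeW.
  apply: noh; apply: (@odd_hole_of_walk w n) => //.
  - by lia.
  - by move=> i /wS/and3P[].
  - move=> i j lt_ij lt_jn eij.
    have [od|od] := boolP (odd (j - i)).
      by apply: (short (j - i) (w i) od); [lia|rewrite {2}eij; apply: seg; lia].
    apply: (short (n - j + i) (w i)); [lia|lia|].
    by rewrite {1}eij; apply: rest; lia.
  move=> i j lt_ij lt_jn eij.
  have rij : r (w i) (w j) by rewrite /= eij !wP //; lia.
  (* The chord closes both arcs into closed walks shorter than [n]; their lengths add up to [n + 2],
     so one of them is odd. *)
  have [/andP[d1 d2]|] := boolP ((1 < j - i) && (j - i < n.-1)); last by lia.
  exfalso; have [od|od] := boolP (odd (j - i)).
    apply: (short (n - j + i).+1 (w j)); [lia|lia|].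
    by apply: (@walkS _ r _ _ (w i)) => //; apply: rest; lia.
  apply: (short (j - i).+1 (w i)); [lia|lia|].
  have rji : r (w j) (w i) by rewrite /= edge_sym eij !wP //; lia.
  by apply: (@walkS _ r _ _ (w j)) => //; apply: seg; lia.
have csym : connect_sym r by apply: sym_connect_sym.
have /fin_all_exists[d dP] := walk_distance r.
(* Color by the parity of the distance to the root of the component: an edge with equal parities
   would close an odd walk at that root. *)
exists (fun x => odd (d (root r x) x)); split=> [x _|x y xP yP exy].
  by case: odd.
have rxy : r x y by rewrite /= xP yP.
have E : root r x = root r y by apply/eqP; rewrite root_connect // connect1.
rewrite E; set z := root r y; have [wz _ _] := dP z.
have wx : walk r (d z x) z x.
  by apply: wz; rewrite csym /z -E connect_root.
have wy : walk r (d z y) z y by apply: wz; rewrite csym connect_root.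
move=> oE; have := @noodd ((d z x).+1 + d z y) z.
rewrite (walk_cat (walkS wx rxy) (walk_sym r_sym wy)).
by move: oE; rewrite addSn /= oddD; case: odd; case: odd => //= _ /(_ isT).
Qed.

(** * Maximal homogeneous sets and the quotient *)

(** A common element [x] links the two constancy conditions. If the union were [X], adjacency
    between [D'] and the rest would be constant, so [X] or its complement graph would be
    disconnected. *)
Lemma overlap_homogeneous X D D' x : linked true X -> linked false X ->
  homogeneous X D -> homogeneous X D' -> D != X -> D' != X ->
  x \in D -> x \in D' ->
  homogeneous X (D :|: D') /\ D :|: D' != X.
Proof.
move=> lt lf /homogeneousP[sD hD] /homogeneousP[sD' hD'] nD nD' xD xD'.
split.
  apply/homogeneousP; split; first by rewrite subUset sD.
  move=> z a b zX; rewrite inE negb_or => /andP[zD zD'].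
  suff H c : c \in D :|: D' -> e z c = e z x by move=> /H-> /H->.
  by case/setUP=> [cD|cD']; [apply: hD | apply: hD'].
apply/eqP=> E.
have pD' : D' \proper X by rewrite properEneq nD'.
have [y yX yD] : exists2 y, y \in X & y \notin D.
  by have /properP[_] : D \proper X by rewrite properEneq nD.
have inD z : z \in X -> z \notin D' -> z \in D.
  by rewrite -E => /setUP[//|->].
have const a b : a \in D' -> b \in X :\: D' -> e a b = e x y.
  move=> aD' /setDP[bX bD']; have bD := inD _ bX bD'.
  have yD' : y \in D' by move: yX; rewrite -E !inE (negbTE yD).
  by rewrite edge_sym (hD' b a y) // edge_sym (hD y b x) // edge_sym.
have n0 : D' != set0 by apply/set0Pn; exists x.
have /linkedP/(_ D' pD' n0)[a [b [aD bD]]] := lt.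
have /linkedP/(_ D' pD' n0)[a' [b' [aD' bD']]] := lf.
by rewrite !const // => ->.
Qed.

(* The quotient of [X] by its maximal proper homogeneous sets, realized on a
   transversal [p @: X]. *)
Lemma colorable_on_quotient X m k : linked true X -> linked false X ->
  1 < #|X| ->
  (forall D, homogeneous X D -> D != X -> colorable_on D k) ->
  (forall P, P \subset X ->
     (forall D a b, homogeneous X D -> D != X -> a \in P -> b \in P ->
        a \in D -> b \in D -> a = b) -> colorable_on P m) ->
  colorable_on X (m * k).
Proof.
move=> lt lf X1 cD cP.
have [x0 x0X] : exists x, x \in X by apply/set0Pn; rewrite -card_gt0 ltnW.
pose ok x D := [&& homogeneous X D, D != X & x \in D].
have ok1 x : x \in X -> ok x [set x].
  move=> xX; apply/and3P; split; rewrite ?set11 //.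
    by apply/homogeneousP; rewrite sub1set; split=> // z a b _ _ /set1P-> /set1P->.
  by apply/eqP=> E; rewrite -E cards1 in X1.
(* By the overlap lemma these largest proper homogeneous sets partition [X]. *)
pose Bl x := [arg max_(D > [set x] | ok x D) #|D|].
have BlP x : x \in X -> ok x (Bl x) /\ forall D, ok x D -> #|D| <= #|Bl x|.
  by move=> xX; rewrite /Bl; case: arg_maxnP => [|D okD H]; [apply: ok1|].
have sub x D y : x \in X -> homogeneous X D -> D != X -> y \in D -> y \in Bl x ->
    D \subset Bl x.
  move=> xX hD nD yD yB; have [/and3P[hB nB xB] mB] := BlP x xX.
  have [hU nU] := overlap_homogeneous lt lf hB hD nB nD yB yD.
  have := mB (Bl x :|: D); rewrite /ok hU nU inE xB => /(_ isT) le.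
  have /eqP -> : Bl x == Bl x :|: D by rewrite eqEcard subsetUl.
  exact: subsetUr.
have BlX x : x \in X -> Bl x \subset X.
  by case/BlP=> /and3P[/homogeneousP[]].
have Bleq x y : x \in X -> y \in Bl x -> Bl y = Bl x.
  move=> xX yB; have yX := subsetP (BlX _ xX) _ yB.
  have [/and3P[hx nx xx] _] := BlP x xX; have [/and3P[hy ny yy] _] := BlP y yX.
  by apply/eqP; rewrite eqEsubset (@sub x (Bl y) y) // (@sub y (Bl x) y).
(* The choice depends only on the set [Bl x], so [p] is constant on each block. *)
pose p x := odflt x0 [pick y in Bl x].
have pB x : x \in X -> p x \in Bl x.
  move=> xX; rewrite /p; case: pickP => //= /(_ x).
  by have [/and3P[_ _ ->]] := BlP x xX.
have pX x : x \in X -> p x \in X by move=> xX; apply: (subsetP (BlX x xX)); apply: pB.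
have pBl x : x \in X -> Bl (p x) = Bl x by move=> xX; apply: Bleq (pB x xX).
have eqp x y : x \in X -> y \in Bl x -> p y = p x.
  by move=> xX yB; rewrite /p (Bleq x y).
have [c [cm cN]] : colorable_on (p @: X) m.
  apply: cP => [|D a b hD nD /imsetP[a' a'X ->] /imsetP[b' b'X ->] aD bD].
    by apply/subsetP=> _ /imsetP[x xX ->]; apply: pX.
  have /subsetP/(_ _ bD) := sub _ _ _ a'X hD nD aD (pB _ a'X).
  by move/(eqp _ _ a'X); rewrite (eqp b') // pB.
apply: (@colorable_on_fibers _ _ p (c \o p)).
- by move=> x xX /=; apply: cm; apply: imset_f.
(* An edge between two blocks carries over to their representatives, moving one end at a time by
   homogeneity. *)
- move=> x y xX yX exy /= cE; apply/eqP; apply: contraPT cE => nE.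
  apply: cN; rewrite ?imset_f //.
  have [/and3P[/homogeneousP[_ hx] _ xx] _] := BlP x xX.
  have [/and3P[/homogeneousP[_ hy] _ yy] _] := BlP y yX.
  rewrite (hy (p x) (p y) y) ?pX ?pB //; last first.
    by apply: contraNN nE => /(eqp _ _ yX); rewrite (eqp x) ?pB // => ->.
  rewrite edge_sym (hx y (p x) x) ?pB // 1?edge_sym //.
  by apply: contraNN nE => /(eqp _ _ xX) ->.
- move=> q; have [->|[x]] := set_0Vmem [set x in X | p x == q].
    exact: colorable_on0.
  rewrite inE => /andP[xX /eqP pq].
  have [/and3P[hx nx _] _] := BlP x xX.
  apply: colorable_onW (leqnn k) (cD _ hx nx); apply/subsetP=> y.
  rewrite inE => /andP[yX /eqP py]; rewrite -(pBl x) // pq -py pBl //.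
  by have [/and3P[]] := BlP y yX.
Qed.

(** * Coloring a layered set *)

Section Layers.
Hypotheses (no_bull : ~ induced_subgraph bull G) (no_hole : ~ has_odd_hole G).
(** [l] stands for the distance to a root; the stability of layers 0 and 1 stops the ascent through
    parents. *)
Variables (S : {set G}) (l : G -> nat).
Hypothesis l_edge : {in S &, forall x y, e x y -> l y <= (l x).+1}.
Hypothesis l_parent : forall n x, x \in S -> l x = n.+1 ->
  exists u, [/\ u \in S, l u = n & e u x].
Hypothesis l_low : {in S &, forall x y, l x = l y -> l x <= 1 -> ~~ e x y}.

Lemma no_edge_far x y : x \in S -> y \in S -> (l x).+1 < l y -> ~~ e x y.
Proof. by move=> xS yS lt; apply/negP=> /(l_edge xS yS); rewrite leqNgt lt. Qed.

(* Otherwise the parents of a, b and c form such a triangle one layer up. *)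
Lemma no_private_triangle n a b c :
  a \in S -> b \in S -> c \in S -> l a = n -> l b = n -> l c = n ->
  e a b -> e b c -> e a c ->
  (forall u, u \in S -> (l u).+1 = n ->
     [/\ ~~ (e u a && e u b), ~~ (e u b && e u c) & ~~ (e u a && e u c)]) ->
  False.
Proof.
elim: n a b c => [|n IHn] a b c aS bS cS la lb lc eab ebc eac H.
  by have := l_low aS bS; rewrite la lb eab => /(_ erefl isT).
case: n IHn la lb lc H => [|n] IHn la lb lc H.
  by have := l_low aS bS; rewrite la lb eab => /(_ erefl isT).
have [u [uS lu eua]] := l_parent aS la.
have [v [vS lv evb]] := l_parent bS lb.
have [w [wS lw ewc]] := l_parent cS lc.
have [] := H u uS (congr1 succn lu); rewrite eua /= => nub _ nuc.
have [] := H v vS (congr1 succn lv); rewrite evb /= andbT => nva nvc _.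
have [] := H w wS (congr1 succn lw); rewrite ewc /= !andbT => _ nwb nwa.
(* Nonadjacent private parents would be the two pendant vertices of a bull on the triangle. *)
have bullN x y z p q : e x y -> e y z -> e x z -> e p x -> e q y ->
  ~~ e p y -> ~~ e p z -> ~~ e q x -> ~~ e q z -> e p q.
  move=> exy eyz exz epx eqy npy npz nqx nqz; apply: contraT => npq.
  by case: no_bull; apply: (@bull_induced x y z p q); rewrite // edge_sym.
have euv : e u v by apply: (bullN a b c).
have evw : e v w by apply: (bullN b c a); rewrite // edge_sym.
have euw : e u w by apply: (bullN a c b); rewrite // edge_sym.
case: n IHn la lb lc lu lv lw {H} => [|n] IHn la lb lc lu lv lw.
  by have := l_low uS vS; rewrite lu lv euv => /(_ erefl isT).
(* The triangle of parents is private too: a common parent [y] of [p] and [q] gives the triangle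
   [y], [p], [q] with pendants [t] above [y] and [x] below [p], a bull. *)
have grand p q x y : p \in S -> q \in S -> x \in S -> l p = n.+2 -> l q = n.+2 ->
    l x = n.+3 -> e p q -> e p x -> ~~ e q x -> y \in S -> (l y).+1 = n.+2 ->
    ~~ (e y p && e y q).
  move=> pS qS xS lp lq lx epq epx nqx yS [ly].
  apply/negP=> /andP[eyp eyq].
  have [t [tS lt ety]] := l_parent yS ly.
  apply: no_bull; apply: (@bull_induced y p q t x) => //.
  - by rewrite edge_sym.
  - by apply: no_edge_far; rewrite ?lt ?lp.
  - by apply: no_edge_far; rewrite ?lt ?lq.
  - by rewrite edge_sym; apply: no_edge_far; rewrite ?ly ?lx.
  - by rewrite edge_sym.
  - by apply: no_edge_far; rewrite ?lt ?lx // ltnW.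
apply: (IHn u v w) => // y yS ly; split.
- exact: (grand u v a).
- exact: (grand v w b).
- exact: (grand u w a).
Qed.

(* D is a component of [N(u) & X]. A vertex x outside [N(u)] that is mixed on D
   is mixed on some edge st of D, say adjacent to s only; the triangle u, s, t
   with the pendant vertices w at u (a parent of u) and x at s is a bull. *)
Lemma nbr_component_homogeneous n X u a :
  X \subset S -> {in X, forall x, l x = n.+2} -> u \in S -> l u = n.+1 ->
  a \in X -> e u a ->
  exists D, [/\ homogeneous X D, {in D, forall x, e u x}, a \in D &
    {in X, forall b, e a b -> e u b -> b \in D}].
Proof.
move=> sXS lX uS lu aX eua.
pose Y := [set x in X | e u x].
have [D [sDY aD lD nD]] : exists C, [/\ C \subset Y, a \in C, linked true C &
    {in C & Y :\: C, forall x y, ~~ e x y}].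
  by apply: component; rewrite inE aX.
have sDX : D \subset X.
  by apply: subset_trans sDY _; apply/subsetP=> x; rewrite inE => /andP[].
have uD : {in D, forall x, e u x}.
  by move=> x /(subsetP sDY); rewrite inE => /andP[].
exists D; split=> //; last first.
  move=> b bX eab eub; apply: contraT => bD.
  by have := nD a b aD; rewrite !inE bD bX eub eab => /(_ isT).
apply/homogeneousP; split=> // x y z xX xD yD zD.
(* A neighbor of [u] outside [D] lies in another component of [Y], so it has no neighbor in [D]. *)
have [eux|neux] := boolP (e u x).
  have H t : t \in D -> e x t = false.
    by move=> tD; rewrite edge_sym; apply/negbTE/nD; rewrite // !inE xD xX.
  by rewrite !H.
suff H y' z' : y' \in D -> z' \in D -> e x y' -> e x z'.
  by apply/idP/idP; apply: H.
move=> {}yD {}zD exy; apply: contraT => nexz.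
pose A := [set t in D | e x t].
have pA : A \proper D.
  apply/properP; split; first by apply/subsetP=> t; rewrite inE => /andP[].
  by exists z' => //; rewrite inE (negbTE nexz) andbF.
have nA : A != set0 by apply/set0Pn; exists y'; rewrite inE yD.
have /linkedP/(_ A pA nA)[s [t []]] := lD.
rewrite !inE => /andP[sD exs] /andP[+ tD]; rewrite tD /= => next est.
have [w [wS lw ewu]] := l_parent uS lu.
have DS p : p \in D -> p \in S /\ l p = n.+2.
  by move/(subsetP sDX) => pX; rewrite lX // (subsetP sXS).
have [[sS ls] [tS ltt]] := (DS _ sD, DS _ tD).
have [xS lx] : x \in S /\ l x = n.+2 by rewrite lX // (subsetP sXS).
case: no_bull; apply: (@bull_induced u s t w x) => //.
- exact: uD.
- exact: uD.
- by rewrite edge_sym.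
- by rewrite edge_sym.
- by apply: no_edge_far; rewrite ?lw ?ls.
- by apply: no_edge_far; rewrite ?lw ?ltt.
- by rewrite edge_sym.
- by apply: no_edge_far; rewrite ?lw ?lx.
Qed.

Variables (k tau : nat).
Hypothesis col_tau : forall Y, clique_bound Y k -> colorable_on Y tau.
Hypothesis cbS : clique_bound S k.+1.

(** The induction is on the clique bound [j] of the subset, with [k] and [tau] fixed. The factor
    [tau + 2] covers both outcomes: doubling the bound for [j], or [tau] colors outright. *)
Lemma colorable_on_layer n j X : X \subset S -> {in X, forall x, l x = n} ->
  clique_bound X j -> colorable_on X ((tau + 2) ^ j).
Proof.
move=> + + cb; elim: j X cb => [|j IHj] X cb sXS lX.
  by rewrite (clique_bound0 cb); apply: colorable_on0.
have pos : 0 < (tau + 2) ^ j by rewrite expn_gt0; lia.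
have IH Y : Y \subset X -> clique_bound Y j -> colorable_on Y ((tau + 2) ^ j).
  move=> sYX cbY; apply: IHj => //; first exact: subset_trans sXS.
  by move=> x /(subsetP sYX)/lX.
move: n lX {IHj} => [|[|n]] lX.
- apply: colorable_on_stable => [|x y xX yX]; first by rewrite expn_gt0; lia.
  by apply: l_low; rewrite ?(subsetP sXS) ?lX.
- apply: colorable_on_stable => [|x y xX yX]; first by rewrite expn_gt0; lia.
  by apply: l_low; rewrite ?(subsetP sXS) ?lX.
apply: colorable_on_components => C sCX lt _.
have {lX} lC : {in C, forall x, l x = n.+2} by move=> x /(subsetP sCX)/lX.
have {}cb := clique_boundW sCX cb.
have {}IH Y : Y \subset C -> clique_bound Y j -> colorable_on Y ((tau + 2) ^ j).
  by move=> sYC; apply: IH; apply: subset_trans sCX.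
have {sXS sCX X} sCS := subset_trans sCX sXS.
suff : colorable_on C (2 * (tau + 2) ^ j) \/ colorable_on C tau.
  case; apply: colorable_onW => //; rewrite expnS.
    by rewrite leq_pmul2r //; lia.
  by apply: leq_trans (leq_pmulr _ pos); lia.
(* If the complement graph is disconnected, [C] is a join, and each side is complete to a vertex of
   the other, which lowers its clique bound. *)
have [lf|/unlinkedP[A [pA nA joinA]]] := boolP (linked false C); last first.
  left; have sAC := proper_sub pA.
  have /properP[_ [b bC bA]] := pA; have [a aA] := set0Pn _ nA.
  apply: (@colorable_on_split _ A) => //.
    rewrite (setIidPr sAC); apply: IH => //; apply: (@clique_bound_nbr C _ b) => //.
    by move=> y yA; rewrite edge_sym joinA // inE bA.
  apply: IH; first exact: subsetDl.
  apply: (@clique_bound_nbr C _ a) => //; first exact: subsetDl.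
    exact: (subsetP sAC).
  by move=> y yD; rewrite joinA.
(* A vertex of [S] complete to [C] brings the clique bound of [C] down to [k]. *)
have [/exists_inP[u uS /andP[/eqP lu /forall_inP uC]]|noC] :=
  boolP [exists u in S, (l u == n.+1) && [forall x in C, e u x]].
  by right; apply: col_tau; apply: (@clique_bound_nbr S _ u).
left; have [C1|C1] := ltnP 1 #|C|; last first.
  apply: colorable_on_stable => [|x y xC yC]; first by rewrite muln_gt0.
  by move/card_le1_eqP: C1 => /(_ x y xC yC)->; rewrite edge_irr.
apply: colorable_on_quotient => // [D hD nD|P sPC notwin].
  have /homogeneousP[sDC hD'] := hD.
  have [->|[d dD]] := set_0Vmem D; first exact: colorable_on0.
  apply: IH => //.
  (* Connectedness gives a vertex outside [D] with a neighbor in [D]; by homogeneity it is complete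
     to [D]. *)
  have /linkedP/(_ D)[||a [b [aD /setDP[bC bD] eab]]] := lt.
  - by rewrite properEneq nD.
  - by apply/set0Pn; exists d.
  apply: (@clique_bound_nbr C _ b) => // y yD.
  by rewrite (hD' b y a) // edge_sym.
apply: triangle_free_bipartite => // a b c aP bP cP eab ebc eac.
have [aC bC cC] := And3 (subsetP sPC _ aP) (subsetP sPC _ bP) (subsetP sPC _ cP).
(* Adjacent representatives with a common parent [u] would share a homogeneous set inside the
   neighborhood of [u], proper because [u] is not complete to [C]. *)
have priv x y u : x \in P -> y \in P -> e x y -> u \in S -> (l u).+1 = n.+2 ->
    ~~ (e u x && e u y).
  move=> xP yP exy uS [lu]; apply/negP=> /andP[eux euy].
  have [xC yC] := (subsetP sPC _ xP, subsetP sPC _ yP).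
  have [D [hD uD xD inD]] := nbr_component_homogeneous sCS lC uS lu xC eux.
  have nD : D != C.
    apply: contraNneq noC => E; apply/exists_inP; exists u => //.
    by rewrite lu eqxx; apply/forall_inP=> z zC; apply: uD; rewrite E.
  have E := notwin D x y hD nD xP yP xD (inD _ yC exy euy).
  by move: exy; rewrite E edge_irr.
apply: (@no_private_triangle n.+2 a b c); rewrite ?lC ?(subsetP sCS) //.
by move=> u uS lu; split; apply: priv.
Qed.

(** Layers of adjacent vertices differ by at most one, so two palettes, alternating with the parity
    of the layer, suffice. *)
Lemma colorable_on_layered : colorable_on S (2 * (tau + 2) ^ k.+1).
Proof.
pose N := \max_(x : G) l x.
have lN x : l x <= N by apply: leq_bigmax.
apply: (@colorable_on_fibers _ _ (fun x => inord (l x) : 'I_N.+1)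
          (fun x => odd (l x))) => [x _|x y xS yS exy oE|i].
- by case: odd.
- congr inord; have := l_edge xS yS exy.
  have := l_edge yS xS; rewrite edge_sym exy => /(_ isT).
  by move: oE; lia.
apply: (@colorable_on_layer i); first by apply/subsetP=> x; rewrite inE => /andP[].
  by move=> x; rewrite inE => /andP[_ /eqP <-]; rewrite inordK // ltnS.
by apply: clique_boundW cbS; apply/subsetP=> x; rewrite inE => /andP[].
Qed.
End Layers.

(** * Induction on the clique number *)

Fixpoint chi_bound k := if k is j.+1 then 4 * (chi_bound j + 2) ^ k else 0.

(* In the layering by the distance to [v], the first layer is just [u]. *)
Lemma colorable_on_beyond v u C k :
  ~ induced_subgraph bull G -> ~ has_odd_hole G ->
  (forall Y, clique_bound Y k -> colorable_on Y (chi_bound k)) ->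
  clique_bound (v |: (u |: C)) k.+1 ->
  linked true C -> {in C, forall x, ~~ e v x} -> e v u ->
  (exists2 x, x \in C & e u x) ->
  colorable_on C (2 * (chi_bound k + 2) ^ k.+1).
Proof.
move=> nb nh IH cb lC vC evu [x0 x0C eux0].
set S := v |: (u |: C) in cb.
pose r := [rel x y | [&& x \in S, y \in S & e x y]].
have [d [dw dle dv]] := walk_distance r v.
have [vS uS] : v \in S /\ u \in S by rewrite !inE !eqxx orbT.
have CS x : x \in C -> x \in S by move=> xC; rewrite !inE xC !orbT.
have cu : connect r v u by apply: connect1; rewrite /= vS uS.
have cC x : x \in C -> connect r v x.
  move=> xC; apply: contraT => ncx.
  (* The reachable part of [C] contains [x0], and an edge leaving it inside [C] would extend it. *)
  pose A := [set y in C | connect r v y].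
  have pA : A \proper C.
    apply/properP; split; first by apply/subsetP=> y; rewrite inE => /andP[].
    by exists x; rewrite // inE (negbTE ncx) andbF.
  have nA : A != set0.
    apply/set0Pn; exists x0; rewrite inE x0C.
    by apply: connect_trans cu (connect1 _); rewrite /= uS CS.
  have /linkedP/(_ A pA nA)[a [b []]] := lC.
  rewrite !inE => /andP[aC ca] /andP[+ bC] eab; rewrite bC => /negP[].
  by apply: connect_trans ca (connect1 _); rewrite /= !CS.
have cS x : x \in S -> connect r v x.
  by rewrite !inE => /or3P[/eqP->|/eqP->|/cC//]; rewrite ?connect0.
have d_edge : {in S &, forall x y, e x y -> d y <= (d x).+1}.
  move=> x y xS yS exy; apply: dle; apply: walkS (dw x (cS x xS)) _.
  by rewrite /= xS yS.
have d_parent n x : x \in S -> d x = n.+1 -> exists u, [/\ u \in S, d u = n & e u x].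
  move=> xS dx; have := dw x (cS x xS).
  rewrite dx => /existsP[z /andP[wz /and3P[zS _ ezx]]]; exists z; split=> //.
  by have := dle _ _ wz; have := d_edge z x zS xS ezx; lia.
have d_low : {in S &, forall x y, d x = d y -> d x <= 1 -> ~~ e x y}.
  have d0 x : x \in S -> d x = 0 -> x = v.
    by move=> xS dx; have := dw x (cS x xS); rewrite dx => /eqP.
  have d1 x : x \in S -> d x = 1 -> x = u.
    move=> xS dx; have [z [zS /(d0 _ zS) -> evx]] := d_parent 0 x xS dx.
    move: xS; rewrite !inE => /or3P[/eqP E|/eqP//|/vC].
      by rewrite E edge_irr in evx.
    by rewrite evx.
  move=> x y xS yS; case dx: (d x) => [|[|//]] /esym dy _.
    by rewrite (d0 x) // (d0 y) // edge_irr.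
  by rewrite (d1 x) // (d1 y) // edge_irr.
apply: (colorable_onW _ (leqnn _)
  (colorable_on_layered nb nh d_edge d_parent d_low IH cb)).
exact/subsetP.
Qed.

Lemma colorable_on_chi_bound k X :
  ~ induced_subgraph bull G -> ~ has_odd_hole G ->
  clique_bound X k -> colorable_on X (chi_bound k).
Proof.
move=> nb nh; elim: k X => [|k IH] X cb.
  by rewrite (clique_bound0 cb); apply: colorable_on0.
apply: colorable_on_components => X' sX lX _.
have {sX X} cb := clique_boundW sX cb; move: X' => X in cb lX *.
have [->|[v vX]] := set_0Vmem X; first exact: colorable_on0.
have pos : 0 < (chi_bound k + 2) ^ k.+1 by rewrite expn_gt0; lia.
(* The outer 2 separates the neighbors of [v] from the rest; the inner 2 comes from the parity of
   the layers. *)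
have -> : chi_bound k.+1 = 2 * (2 * (chi_bound k + 2) ^ k.+1).
  by rewrite mulnA.
pose N := [set x in X | e v x].
have sNX : N \subset X by apply/subsetP=> x; rewrite inE => /andP[].
apply: (@colorable_on_split _ N) => //.
  rewrite (setIidPr sNX).
  have cN : clique_bound N k.
    by apply: (@clique_bound_nbr X _ v) => // x; rewrite inE => /andP[].
  apply: colorable_onW (subxx _) _ (IH N cN); rewrite expnS.
  have : 0 < (chi_bound k + 2) ^ k by rewrite expn_gt0; lia.
  by nia.
apply: colorable_on_components => C sC lC nC.
have sCX : C \subset X by apply: subset_trans sC (subsetDl _ _).
have vC : {in C, forall x, ~~ e v x}.
  move=> x /(subsetP sC); rewrite !inE => /andP[+ xX]; by rewrite xX.
have [->|[c cC]] := set_0Vmem C; first exact: colorable_on0.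
(* The vertex [v] remains in [X :\: N], where it is isolated, so its component is a singleton. *)
have [vinC|vnC] := boolP (v \in C).
  have [/eqP E|nE] := boolP ([set v] == C).
    apply: colorable_on_stable => [|x y]; first by rewrite muln_gt0.
    by rewrite -E => /set1P-> /set1P->; rewrite edge_irr.
  have /linkedP/(_ [set v])[||a [b [/set1P-> /setDP[bC _]]]] := lC.
  - by rewrite properEneq nE sub1set.
  - by apply/set0Pn; exists v; rewrite set11.
  - by rewrite (negbTE (vC _ bC)).
(* Connectedness of [X] gives an edge leaving [C]; its outer end must be in [N], as [C] is a
   component of [X :\: N]. *)
have /linkedP/(_ C)[||x [u [xC /setDP[uX uC] exu]]] := lX.
- by apply/properP; split=> //; exists v.
- by apply/set0Pn; exists c.
have evu : e v u.
  apply: contraT => nvu; have := nC x u xC.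
  by rewrite !inE uX uC (negbTE nvu) exu => /(_ isT).
apply: (@colorable_on_beyond v u) => //; last by exists x; rewrite // edge_sym.
by apply: clique_boundW cb; rewrite !subUset !sub1set vX uX.
Qed.
End Graph.

Theorem theorem8p3 : chi_bounded bull_odd_hole_free.
Proof.
exists chi_bound => G [nb nh].
have cb : @clique_bound G setT (clique_number G).
  by move=> A _ cA; apply: (@leq_bigmax_cond _ _ (fun A : {set G} => #|A|)).
have [c [ck cP]] := colorable_on_chi_bound nb nh cb.
rewrite /chromatic_number; case: ex_minnP => m _; apply.
have ck' x : c x < chi_bound (clique_number G) by apply: ck; rewrite inE.
apply/existsP; exists [ffun x => Ordinal (ck' x)].
apply/forallP=> x; apply/forallP=> y; apply/implyP=> exy.
by rewrite !ffunE -val_eqE /=; apply/eqP; apply: cP; rewrite ?inE.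
Qed.
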